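(* Let $p\geq 5$ be any fixed prime, and for $c\in\mathbb{Z}_p$ let $\varphi_{p-1,c}$ be the polynomial map defined by $\varphi_{p-1,c}(z)=z^{p-1}+c$ for all $z\in\mathbb{Z}_p$. Then for every $c\in\mathbb{Z}_p$ the number of distinct $p$-adic integral fixed points of $\varphi_{p-1,c}$ modulo $p\mathbb{Z}_p$ is $1$ or $2$ or $0$.
   Context: $\mathbb{Z}_p$ is the ring of $p$-adic integers. The number of distinct $p$-adic integral fixed points of $\varphi_{p-1,c}$ modulo $p\mathbb{Z}_p$ means $\#\{z\in\mathbb{Z}_p/p\mathbb{Z}_p : \varphi_{p-1,c}(z)-z\equiv 0 \pmod{p\mathbb{Z}_p}\}$. *)

(* Defs.v *)
From HB Require Import structures.
From mathcomp Require Import all_boot all_order all_algebra.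
From mathcomp Require Import all_classical.
Set Implicit Arguments.
Unset Strict Implicit.
Unset Printing Implicit Defensive.
Import GRing.Theory.
Local Open Scope classical_set_scope.
Local Open Scope ring_scope.
Local Open Scope quotient_scope.

Section PadicIntegers.
Variables (p : nat) (p_pr : prime p).

(* Z_p as the inverse limit of the rings Z/p^(n+1), n >= 0, along the
   reduction maps. Levels start at p^1 because 'Z_1 is not the trivial ring;
   p_pr is kept as a parameter of the type so that every level is a genuine
   Z/p^(n+1). *)
Definition coherent (x : forall n, 'Z_(p ^ n.+1)) : Prop :=
  forall n, (x n.+1 : nat)%:R = x n.

Definition padic_int (_ : prime p) : Type := {x | coherent x}.
Local Notation Zp := (padic_int p_pr).

HB.instance Definition _ := gen_eqMixin Zp.
HB.instance Definition _ := gen_choiceMixin Zp.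

Definition padic_proj n (x : Zp) : 'Z_(p ^ n.+1) := sval x n.

Lemma padic_projS (x : Zp) n : (padic_proj n.+1 x : nat)%:R = padic_proj n x.
Proof. exact: (svalP x n). Qed.

Lemma padic_proj_inj (x y : Zp) :
  (forall n, padic_proj n x = padic_proj n y) -> x = y.
Proof.
move: x y => [x xP] [y yP] xy.
have {}xy : x = y by apply: functional_extensionality_dep => n; apply: xy.
by case: _ / xy in yP *; congr exist; apply: Prop_irrelevance.
Qed.

Lemma level_gt1 n : (1 < p ^ n.+1)%N.
Proof. by rewrite -(exp1n n.+1) ltn_exp2r // prime_gt1. Qed.

Lemma natr_level (n k : nat) : ((k %% p ^ n.+2)%:R : 'Z_(p ^ n.+1)) = k%:R.
Proof.
rewrite -(Zp_nat_mod (level_gt1 n)) modn_dvdm ?Zp_nat_mod ?level_gt1 //.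
by rewrite dvdn_exp2l.
Qed.

Lemma levelD n (a b : 'Z_(p ^ n.+1)) :
  nat_of_ord (a + b) = ((a + b)%N %% p ^ n.+1)%N.
Proof. by rewrite /= {3}Zp_cast ?level_gt1. Qed.

Lemma levelM n (a b : 'Z_(p ^ n.+1)) :
  nat_of_ord (a * b) = ((a * b)%N %% p ^ n.+1)%N.
Proof. by rewrite /= {3}Zp_cast ?level_gt1. Qed.

Lemma coherent0 : coherent (fun=> 0).
Proof. by move=> n. Qed.

Lemma coherent1 : coherent (fun=> 1).
Proof. by move=> n. Qed.

Lemma coherentD (x y : Zp) :
  coherent (fun n => padic_proj n x + padic_proj n y).
Proof. by move=> n; rewrite levelD natr_level natrD !padic_projS. Qed.

Lemma coherentM (x y : Zp) :
  coherent (fun n => padic_proj n x * padic_proj n y).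
Proof. by move=> n; rewrite levelM natr_level natrM !padic_projS. Qed.

Lemma coherentN (x : Zp) : coherent (fun n => - padic_proj n x).
Proof.
move=> n; apply/eqP; rewrite -addr_eq0 -(padic_projS x n) -natrD -natr_level.
by rewrite -levelD addNr.
Qed.

Definition padic0 : Zp := exist _ _ coherent0.
Definition padic1 : Zp := exist _ _ coherent1.
Definition padicD (x y : Zp) : Zp := exist _ _ (coherentD x y).
Definition padicM (x y : Zp) : Zp := exist _ _ (coherentM x y).
Definition padicN (x : Zp) : Zp := exist _ _ (coherentN x).

Lemma padicDA : associative padicD.
Proof. by move=> x y z; apply: padic_proj_inj => n; apply: addrA. Qed.
Lemma padicDC : commutative padicD.
Proof. by move=> x y; apply: padic_proj_inj => n; apply: addrC. Qed.
Lemma padic0D : left_id padic0 padicD.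
Proof. by move=> x; apply: padic_proj_inj => n; apply: add0r. Qed.
Lemma padicND : left_inverse padic0 padicN padicD.
Proof. by move=> x; apply: padic_proj_inj => n; apply: addNr. Qed.
Lemma padicMA : associative padicM.
Proof. by move=> x y z; apply: padic_proj_inj => n; apply: mulrA. Qed.
Lemma padicMC : commutative padicM.
Proof. by move=> x y; apply: padic_proj_inj => n; apply: mulrC. Qed.
Lemma padic1M : left_id padic1 padicM.
Proof. by move=> x; apply: padic_proj_inj => n; apply: mul1r. Qed.
Lemma padicMDl : left_distributive padicM padicD.
Proof. by move=> x y z; apply: padic_proj_inj => n; apply: mulrDl. Qed.
Lemma padic1_neq0 : padic1 != padic0.
Proof. by apply/eqP => /(congr1 (padic_proj 0)) /eqP; rewrite /= oner_eq0. Qed.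

HB.instance Definition _ :=
  GRing.isZmodule.Build Zp padicDA padicDC padic0D padicND.
HB.instance Definition _ :=
  GRing.Zmodule_isComNzRing.Build Zp padicMA padicMC padic1M padicMDl
    padic1_neq0.

Lemma padic_proj_is_zmod_morphism n : zmod_morphism (padic_proj n).
Proof. by []. Qed.
Lemma padic_proj_is_monoid_morphism n : monoid_morphism (padic_proj n).
Proof. by []. Qed.
HB.instance Definition _ n :=
  GRing.isZmodMorphism.Build Zp 'Z_(p ^ n.+1) (padic_proj n)
    (@padic_proj_is_zmod_morphism n).
HB.instance Definition _ n :=
  GRing.isMonoidMorphism.Build Zp 'Z_(p ^ n.+1) (padic_proj n)
    (@padic_proj_is_monoid_morphism n).

Definition pZp : {pred Zp} := fun x => `[< exists y, x = p%:R * y >].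

Lemma pZp_idealr_closed : idealr_closed pZp.
Proof.
split.
- by apply/asboolP; exists 0; rewrite mulr0.
- apply/negP => /asboolP[y /(congr1 (padic_proj 0))].
  rewrite rmorphM rmorph_nat rmorph1 => /eqP.
  have -> : p%:R = 0 :> 'Z_(p ^ 1).
    by apply: etrans (pchar_Zp (level_gt1 0)); congr _%:R; rewrite expn1.
  by rewrite mul0r oner_eq0.
- move=> a x y /asboolP[u ->] /asboolP[v ->]; apply/asboolP; exists (a * u + v).
  by rewrite mulrDr mulrCA.
Qed.

HB.instance Definition _ := isIdealr.Build Zp pZp pZp_idealr_closed.

Definition phi (c z : Zp) : Zp := z ^+ p.-1 + c.

Definition fixed_points_mod (c : Zp) : set {ideal_quot pZp} :=
  [set \pi_({ideal_quot pZp}) z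
     | z in [set z | phi c z - z = 0 %[ mod_ideal pZp ]]].

End PadicIntegers.

(* Main.v *)
Require Import Defs.
From mathcomp Require Import all_boot all_order all_algebra.
From mathcomp Require Import all_classical.
From mathcomp Require Import cyclic.
Local Open Scope classical_set_scope.
Local Open Scope card_scope.

(** The residue ring [Z_p / p Z_p] is the field with [p] elements, so Fermat's
    little theorem applies in it: every [z] outside [p Z_p] satisfies
    [z ^ (p - 1) = 1] modulo [p] ([Fermat_mod_pZp]). The fixed-point equation
    [z ^ (p - 1) + c = z] therefore degenerates: a unit [z] solves it modulo [p]
    only if [z = 1 + c], and the one remaining class is that of [0]. So the
    fixed points modulo [p] are among the classes of [0] and [1 + c]
    ([fixed_points_mod_sub]), which leaves the cardinals 0, 1 and 2.

    The bridge between the ideal [p Z_p] and arithmetic modulo [p] is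
    [mem_pZp]: a coherent sequence whose first term vanishes is [p] times
    another coherent sequence. *)

Section FixedPoints.
Import GRing.Theory.
Local Open Scope ring_scope.
Local Open Scope quotient_scope.
Variables (p : nat) (p_pr : prime p).
Local Notation Zp := (padic_int p_pr).
Implicit Types x z c : Zp.

Lemma padic_projS_nat x n :
  (padic_proj n.+1 x %% p ^ n.+1)%N = padic_proj n x :> nat.
Proof. by rewrite -(padic_projS x n) val_Zp_nat ?level_gt1. Qed.

Lemma dvdn_padic_proj x n :
  padic_proj 0 x = 0 -> (p %| (padic_proj n x : nat))%N.
Proof.
move=> x0; elim: n => [|n IHn]; first by rewrite x0 dvdn0.
by move: IHn; rewrite -padic_projS_nat /dvdn modn_dvdm // dvdn_exp.
Qed.

(** Division by [p] costs one level of precision, hence the shift: the [n]-th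
    term of [x / p] is read off the term of index [n + 1]. *)
Lemma coherent_divp x : padic_proj 0 x = 0 ->
  coherent (fun n => ((padic_proj n.+1 x %/ p)%N%:R : 'Z_(p ^ n.+1))).
Proof.
move=> x0 n; rewrite val_Zp_nat ?level_gt1 // natr_level //.
rewrite -(padic_projS_nat x n.+1).
have /dvdnP[k ->] := dvdn_padic_proj x n.+2 x0.
rewrite [(p ^ n.+2)%N]expnSr -muln_modl !mulnK ?prime_gt0 //.
by rewrite Zp_nat_mod ?level_gt1.
Qed.

Lemma mem_pZp x : (x \in @pZp p p_pr) = (padic_proj 0 x == 0).
Proof.
apply/asboolP/eqP => [[y ->]|x0].
  rewrite rmorphM rmorph_nat.
  have -> : p%:R = 0 :> 'Z_(p ^ 1).
    by rewrite -[p in p%:R]expn1; apply: pchar_Zp; rewrite level_gt1.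
  exact: mul0r.
exists (exist _ _ (coherent_divp x x0)); apply: padic_proj_inj => n.
rewrite rmorphM rmorph_nat /= /padic_proj /= -natrM mulnC divnK.
  by rewrite padic_projS.
exact: dvdn_padic_proj.
Qed.

Lemma Fermat_mod_pZp z : z \notin @pZp p p_pr -> z ^+ p.-1 - 1 \in @pZp p p_pr.
Proof.
rewrite !mem_pZp rmorphB rmorphXn rmorph1 subr_eq0.
have p1 : (1 < p ^ 1)%N by rewrite level_gt1.
set a := padic_proj 0 z => a0.
have ca : coprime a (p ^ 1).
  rewrite coprime_sym coprime_pexpl // prime_coprime // gtnNdvd //.
    by rewrite lt0n; apply: contra a0 => /eqP ?; apply/eqP/val_inj.
  have := ltn_ord a.
  by rewrite [X in (_ < X)%N]Zp_cast // [X in (_ < X)%N]expn1.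
have tot_p : totient (p ^ 1) = p.-1 by rewrite expn1 totient_prime.
have -> : a ^+ p.-1 = (a ^ p.-1)%N%:R by rewrite natrX natr_Zp.
by rewrite -Zp_nat_mod // -tot_p Euler_exp_totient // Zp_nat_mod.
Qed.

Lemma fixed_points_mod_sub c :
  fixed_points_mod c `<=`
    [set \pi_({ideal_quot (@pZp p p_pr)}) 0;
         \pi_({ideal_quot (@pZp p p_pr)}) (1 + c)].
Proof.
move=> _ [z /= /eqP + <-]; rewrite -Quotient.idealrBE subr0 => fz.
have [z0|z_unit] := boolP (z \in @pZp p p_pr); [left|right].
  by apply/eqP; rewrite -Quotient.idealrBE subr0.
apply/eqP; rewrite -Quotient.idealrBE.
have -> : z - (1 + c) = (z ^+ p.-1 - 1) - (phi c z - z).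
  rewrite /phi opprB [RHS]addrC [_ ^+ _ + c]addrC !opprD !addrA subrK.
  by rewrite addrAC.
by rewrite rpredB // Fermat_mod_pZp.
Qed.

End FixedPoints.

Lemma card_set2 (T : Type) (a b : T) : a <> b -> [set a; b] #= `I_2.
Proof.
move=> ab; apply/eq_cardSP; exists a; first by left.
suff -> : [set a; b] `\ a = [set b] by exact: card_set1.
apply/seteqP; split=> [y [[]]//|y ->]; split; first by right.
by move=> /esym.
Qed.

Lemma card_sub_set2 (T : Type) (A : set T) (a b : T) :
  A `<=` [set a; b] -> A #= `I_1 \/ A #= `I_2 \/ A #= `I_0.
Proof.
case/subset_set2 => ->.
- by right; right; rewrite II0 card_eq0.
- by left; exact: card_set1.
- by left; exact: card_set1.
- have [->|ab] := pselect (a = b); last by right; left; exact: card_set2.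
  by left; rewrite setUid; exact: card_set1.
Qed.

Theorem theorem1p3 (p : nat) (p_pr : prime p) (p_ge5 : (5 <= p)%N)
    (c : padic_int p_pr) :
  fixed_points_mod c #= `I_1 \/ fixed_points_mod c #= `I_2 \/
  fixed_points_mod c #= `I_0.
Proof. exact: card_sub_set2 (fixed_points_mod_sub _ _ c). Qed.
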